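(* Let $d\ge1$ be an integer and let $h(z_1,\dots,z_d)=\sum_{k\in[n]^d}c_kz_1^{k_1}\cdots z_d^{k_d}$ be a nonzero polynomial with each $c_k\in\{0,\pm1\}$. Then for any $L\ge1$, $$\max_{z_1,\dots,z_d\in\gamma(L)}|h(z_1,\dots,z_d)|\ \ge\ e^{-O(Ln\log n)},$$ where the constant implied by $O(\cdot)$ depends only on $d$.
   Context: $[n]=\{0,1,\dots,n-1\}$, and for $L\ge1$, $\gamma(L)=\{e^{i\theta}:-\pi/L\le\theta\le\pi/L\}\subset\mathbb{C}$. *)

(* Defs.v *)
From HB Require Import structures.
From mathcomp Require Import all_boot all_order all_algebra.
From mathcomp Require Import complex.
(* The notations of mpoly clash with those of mathcomp-analysis. *)
From mathcomp Require Import (canonicals, coercions) mpoly.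
From mathcomp Require Import all_classical all_reals all_analysis.

Set Implicit Arguments.
Unset Strict Implicit.
Unset Printing Implicit Defensive.

Import Order.TTheory GRing.Theory Num.Theory.

Local Open Scope classical_set_scope.
Local Open Scope ring_scope.
Local Open Scope complex_scope.

Definition expi (R : realType) (theta : R) : R[i] := cos theta +i* sin theta.

Definition gamma (R : realType) (L : R) : set R[i] :=
  [set expi theta | theta in `[- (pi / L), pi / L]].

Definition box_poly (R : realType) (d n : nat)
    (c : {ffun 'I_d -> 'I_n} -> R[i]) : mpoly.mpoly d R[i] :=
  \sum_(k : {ffun 'I_d -> 'I_n})
    c k *: mpoly.mpolyX R[i] (mpoly.Multinom [tuple (k i : nat) | i < d]).

(* Values of |h| on gamma(L)^d; [normc] is the modulus as an element of R,
   whereas the library norm `|_| on R[i] takes values in R[i]. *)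
Definition moduli (R : realType) (d : nat) (h : mpoly.mpoly d R[i]) (L : R) :
    set R :=
  [set ComplexField.Normc.normc (mpoly.meval z h) |
    z in [set z : 'I_d -> R[i] | forall i, gamma L (z i)]].

Definition is_max (R : realType) (A : set R) (M : R) : Prop :=
  A M /\ ubound A M.

(* Main.v *)
(** A polynomial with n coefficients per variable is determined by its values
    on the grid X^d, where X consists of n points of the arc: reading a
    coefficient off the values is a tensor power of Lagrange interpolation, whose
    weights have l^1-norm at most (4/delta)^(n-1) when the points of X are
    delta-separated. The points exp(i / (L (j+1))), 0 <= j < n, are
    c/(L n^2)-separated, and some coefficient has modulus 1, so the maximum is at
    least (c' L n^2)^(-(n-1)d). Since log L <= L, this is already of the
    required size. *)

Require Import Defs.
From HB Require Import structures.
From mathcomp Require Import all_boot all_order all_algebra.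
From mathcomp Require Import complex.
From mathcomp Require Import (canonicals, coercions) mpoly.
From mathcomp Require Import all_classical all_reals all_analysis.
From mathcomp Require Import ring lra.

Set Implicit Arguments.
Unset Strict Implicit.
Unset Printing Implicit Defensive.

Import Order.TTheory GRing.Theory Num.Theory.
Import numFieldNormedType.Exports.

Local Open Scope classical_set_scope.
Local Open Scope ring_scope.

(** * Reading coefficients off values by Lagrange interpolation *)

(** The coefficient at k of (X - y) q is q_(k-1) - y q_k, so a factor with |y| <= 1 at most doubles
    a bound common to all coefficients. *)
Lemma norm_coef_prod_XsubC_le (F : numDomainType) (I : Type) (r : seq I)
    (P : pred I) (x : I -> F) (k : nat) :
  (forall i, `|x i| <= 1) ->
  `|(\prod_(i <- r | P i) ('X - (x i)%:P))`_k| <= 2 ^+ count P r.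
Proof.
move=> x1; elim: r k => [|i r IHr] k.
  by rewrite big_nil coef1 normr_nat /= lern1; case: (k == 0)%N.
rewrite big_cons /=; case: (P i) => //=.
rewrite add1n exprS mulr_natl mulr2n mulrBl coefB coefXM coefCM.
apply: le_trans (ler_normB _ _) _; apply: lerD.
  by case: (k == 0)%N; rewrite ?normr0 ?exprn_ge0.
rewrite normrM; apply: le_trans (IHr k).
by rewrite ler_piMl.
Qed.

Lemma leqn_exp2_pred n : (n <= 2 ^ n.-1)%N.
Proof. by case: n => // n; exact: ltn_expl. Qed.

(** The weights are the coefficients at [k] of the Lagrange basis polynomials. Their numerators are
    products of n-1 linear factors, and their denominators are products of n-1 distances between
    nodes. *)
Lemma interpolation_weights (F : numFieldType) (n : nat) (x : nat -> F)
    (delta : F) (k : 'I_n) :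
  injective x -> (forall j, `|x j| <= 1) -> 0 < delta ->
  (forall i j : 'I_n, i != j -> delta <= `|x i - x j|) ->
  exists w : 'I_n -> F,
    (forall m : 'I_n, \sum_(j < n) w j * x j ^+ m = (m == k)%:R) /\
    \sum_(j < n) `|w j| <= (4 / delta) ^+ n.-1.
Proof.
move=> x_inj x1 delta0 xsep.
have n0 : (0 < n)%N by exact: leq_ltn_trans (ltn_ord k).
exists (fun j => (tnth (qpoly.lagrange n x) j : {poly F})`_k); split.
  (* Since m < n, interpolation reproduces X^m exactly; the identity compares coefficients at
     [k]. *)
  move=> m; have szXm : (size ('X^m : {poly F}) <= n)%N.
    by rewrite size_polyXn.
  have /(congr1 (fun p : {poly F} => p`_k)) := lagrange_gen n0 x_inj szXm.
  rewrite coefXn coef_sum eq_sym => ->; apply: eq_bigr => j _.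
  by rewrite coefCM hornerXn mulrC.
have cardj (j : 'I_n) : #|[pred i : 'I_n | i != j]| = n.-1.
  by rewrite -[n in RHS]card_ord -(cardC1 j); apply: eq_card.
have wle (j : 'I_n) :
    `|(tnth (qpoly.lagrange n x) j : {poly F})`_k| <= (2 / delta) ^+ n.-1.
  rewrite lagrangeE //= coefCM normrM normfV mulrC expr_div_n.
  have ple : delta ^+ n.-1 <= `|(\prod_(i < n | i != j) ('X - (x i)%:P)).[x j]|.
    rewrite horner_prod normr_prod -(cardj j) -prodr_const.
    apply: ler_prod => i ij.
    by rewrite (ltW delta0) /= hornerXsubC distrC xsep.
  have d0 : 0 < delta ^+ n.-1 by rewrite exprn_gt0.
  rewrite ler_pM ?invr_ge0 ?lef_pV2 ?posrE // ?(lt_le_trans d0) //.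
  apply: le_trans (norm_coef_prod_XsubC_le _ _ _ _) _ => //.
  by rewrite -sum1_count sum1_card cardj.
(* Summing n weights costs a factor n <= 2^(n-1), which turns the 2 into 4. *)
apply: le_trans (ler_sum _ (fun j _ => wle j)) _.
rewrite sumr_const card_ord -[_ *+ n]mulr_natl.
have -> : 4 / delta = 2 * (2 / delta) by rewrite mulrA -natrM.
rewrite [leRHS]exprMn ler_wpM2r //.
  by rewrite exprn_ge0 // divr_ge0 // ltW.
by rewrite -natrX ler_nat leqn_exp2_pred.
Qed.

(** The product weights, one factor per coordinate, isolate [a k] among the grid values; their
    l^1-norm is the product of the d one-dimensional ones. *)
Lemma norm_coef_le_grid (F : numFieldType) (d n : nat) (x : nat -> F)
    (w : 'I_n -> 'I_n -> F) (K M : F) (a : {ffun 'I_d -> 'I_n} -> F) :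
  (forall k m : 'I_n, \sum_(j < n) w k j * x j ^+ m = (m == k)%:R) ->
  (forall k, \sum_(j < n) `|w k j| <= K) ->
  (forall j : {ffun 'I_d -> 'I_n},
    `|\sum_(l : {ffun 'I_d -> 'I_n}) a l * \prod_i x (j i) ^+ l i| <= M) ->
  forall k, `|a k| <= K ^+ d * M.
Proof.
move=> wx wK aM k.
have -> : a k = \sum_(j : {ffun 'I_d -> 'I_n}) (\prod_i w (k i) (j i)) *
    \sum_(l : {ffun 'I_d -> 'I_n}) a l * \prod_i x (j i) ^+ l i.
  under eq_bigr do rewrite mulr_sumr.
  rewrite exchange_big /=.
  have E (l : {ffun 'I_d -> 'I_n}) :
      \sum_(j : {ffun 'I_d -> 'I_n}) (\prod_i w (k i) (j i)) *
        (a l * \prod_i x (j i) ^+ l i) = a l * (l == k)%:R.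
    under eq_bigr do rewrite mulrCA -big_split /=.
    (* By distributivity the grid sum is a product over coordinates of one-dimensional sums; one
       coordinate where [l] and [k] differ makes it vanish. *)
    rewrite -mulr_sumr -(bigA_distr_bigA (fun i j => w (k i) j * x j ^+ l i)).
    under eq_bigr do rewrite wx.
    congr (_ * _); case: eqP => [->|/eqP lk].
      by rewrite big1 // => i _; rewrite eqxx.
    have [i ik] : exists i, l i != k i.
      by apply/existsP; apply: contraR lk => /existsPn lk; apply/eqP/ffunP => i;
        apply/eqP; rewrite -[_ == _]negbK.
    by rewrite (bigD1 i) //= (negPf ik) mul0r.
  under eq_bigr do rewrite E.
  rewrite (bigD1 k) //= eqxx mulr1 big1 ?addr0 // => l /negPf ->.
  by rewrite mulr0.
apply: le_trans (ler_norm_sum _ _ _) _.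
apply: (@le_trans _ _
  (\sum_(j : {ffun 'I_d -> 'I_n}) (\prod_i `|w (k i) (j i)|) * M)).
  by apply: ler_sum => j _; rewrite normrM normr_prod ler_wpM2l ?prodr_ge0.
rewrite -mulr_suml -(bigA_distr_bigA (fun i j => `|w (k i) j|)).
(* Here 0 <= M because M bounds a norm, taken at [k] read as a grid index. *)
apply: ler_wpM2r; first by apply: le_trans (aM k).
rewrite -[d in K ^+ d]card_ord -prodr_const; apply: ler_prod => i _.
by rewrite wK sumr_ge0.
Qed.

(** * Continuity, and existence of the maximum *)

(* The library does not relate the topology of R[i] to that of R, hence
   continuity is stated on real and imaginary parts. *)
Definition re_im_continuous (R : realType) (T : topologicalType)
    (F : T -> R[i]) :=
  continuous (fun t => complex.Re (F t)) /\
  continuous (fun t => complex.Im (F t)).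

Section ReImContinuous.
Variables (R : realType) (T : topologicalType).
Implicit Types F G : T -> R[i].

Lemma re_im_continuous_cst (a : R[i]) : re_im_continuous (fun _ : T => a).
Proof. by split=> t; exact: cvg_cst. Qed.

Lemma re_im_continuousD F G : re_im_continuous F -> re_im_continuous G ->
  re_im_continuous (fun t => F t + G t).
Proof.
move=> [Fr Fi] [Gr Gi]; split=> t.
- under eq_fun do rewrite raddfD /=.
  exact: cvgD (Fr t) (Gr t).
- under eq_fun do rewrite raddfD /=.
  exact: cvgD (Fi t) (Gi t).
Qed.

Lemma re_im_continuousM F G : re_im_continuous F -> re_im_continuous G ->
  re_im_continuous (fun t => F t * G t).
Proof.
move=> [Fr Fi] [Gr Gi]; split=> t.
- have -> : (fun t => complex.Re (F t * G t)) = (fun t =>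
      complex.Re (F t) * complex.Re (G t) -
      complex.Im (F t) * complex.Im (G t)).
    by apply/funext => u; case: (F u) (G u) => [a b] [c d].
  exact: cvgB (cvgM (Fr t) (Gr t)) (cvgM (Fi t) (Gi t)).
- have -> : (fun t => complex.Im (F t * G t)) = (fun t =>
      complex.Re (F t) * complex.Im (G t) +
      complex.Im (F t) * complex.Re (G t)).
    by apply/funext => u; case: (F u) (G u) => [a b] [c d].
  exact: cvgD (cvgM (Fr t) (Gi t)) (cvgM (Fi t) (Gr t)).
Qed.

Lemma re_im_continuous_sum (I : Type) (r : seq I) (F : I -> T -> R[i]) :
  (forall i, re_im_continuous (F i)) ->
  re_im_continuous (fun t => \sum_(i <- r) F i t).
Proof.
move=> Fc; elim: r => [|i r IHr].
  under eq_fun do rewrite big_nil.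
  exact: re_im_continuous_cst.
under eq_fun do rewrite big_cons.
exact: re_im_continuousD.
Qed.

Lemma re_im_continuous_prod (I : Type) (r : seq I) (F : I -> T -> R[i]) :
  (forall i, re_im_continuous (F i)) ->
  re_im_continuous (fun t => \prod_(i <- r) F i t).
Proof.
move=> Fc; elim: r => [|i r IHr].
  under eq_fun do rewrite big_nil.
  exact: re_im_continuous_cst.
under eq_fun do rewrite big_cons.
exact: re_im_continuousM.
Qed.

Lemma re_im_continuousX F k : re_im_continuous F ->
  re_im_continuous (fun t => F t ^+ k).
Proof.
move=> Fc; elim: k => [|k IHk]; first exact: re_im_continuous_cst.
under eq_fun do rewrite exprS.
exact: re_im_continuousM.
Qed.

Lemma re_im_continuous_normc F : re_im_continuous F ->
  continuous (fun t => ComplexField.Normc.normc (F t)).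
Proof.
move=> [Fr Fi] t.
have -> : (fun t => ComplexField.Normc.normc (F t)) = (fun t =>
    Num.sqrt (complex.Re (F t) ^+ 2 + complex.Im (F t) ^+ 2)).
  by apply/funext => u; case: (F u).
apply: continuous_comp; last exact: sqrt_continuous.
exact: cvgD (cvgM (Fr t) (Fr t)) (cvgM (Fi t) (Fi t)).
Qed.

End ReImContinuous.

(** The angles parametrise gamma(L)^d by a compact box of row vectors, on which the extreme value
    theorem applies. *)
Lemma is_max_moduli (R : realType) (d : nat) (h : mpoly.mpoly d R[i]) (L : R) :
  0 < L -> exists M : R, is_max (moduli h L) M.
Proof.
move=> L0.
pose z (v : 'rV[R]_d) (i : 'I_d) : R[i] := expi (v ord0 i).
pose f v := ComplexField.Normc.normc (mpoly.meval (z v) h).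
have fc : continuous f.
  apply: re_im_continuous_normc; under eq_fun do rewrite mpoly.mevalE.
  apply: re_im_continuous_sum => m.
  apply: re_im_continuousM; first exact: re_im_continuous_cst.
  apply: re_im_continuous_prod => i; apply: re_im_continuousX.
  split=> v; apply: continuous_comp; try exact: coord_continuous.
  - exact: continuous_cos.
  - exact: continuous_sin.
pose A : set 'rV[R]_d :=
  [set v | forall i, `[- (pi / L), pi / L]%classic (v ord0 i)].
have A0 : A !=set0.
  exists 0 => i; rewrite /= in_itv /= mxE oppr_le0.
  by rewrite divr_ge0 ?pi_ge0 ?ltW.
have Ac : compact A.
  apply: (@rV_compact _ _ (fun=> `[- (pi / L), pi / L]%classic)) => i.
  exact: segment_compact.
have [v /set_mem Av fv] := compact_EVT_max A0 Ac (continuous_subspaceT fc).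
exists (f v); split.
  exists (z v) => // i; exists (v ord0 i) => //; exact: Av.
move=> _ [y yL <-].
have {}yL i : exists t, `[- (pi / L), pi / L]%classic t /\ expi t = y i.
  by have [t tL <-] := yL i; exists t.
have [t tL] := choice yL.
have -> : y = z (\row_i t i).
  by apply/funext => i; rewrite /z mxE (tL i).2.
apply: fv; apply/mem_set => i; rewrite mxE; exact: (tL i).1.
Qed.

(** * Separation of the nodes on the arc *)

(** Mean value theorem: the derivative cos is decreasing on [0, pi], hence at least cos 1 on
    [0, 1]. *)
Lemma sin_dist_ge (R : realType) (a b : R) :
  0 <= a <= 1 -> 0 <= b <= 1 -> cos 1 * `|a - b| <= `|sin a - sin b|.
Proof.
wlog ab : a b / b < a => [wlg|].
  have [ab|ab|<-] := ltgtP a b; last by rewrite !subrr normr0 mulr0.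
    by move=> a1 b1; rewrite distrC [leRHS]distrC; exact: wlg.
  exact: wlg.
move=> /andP[a0 a1] /andP[b0 b1].
have [c] := MVT ab (fun x _ => is_derive_sin x)
  (continuous_subspaceT (@continuous_sin R)).
rewrite in_itv /= => /andP[bc ca] ->.
have c0 : 0 <= c by rewrite (le_trans b0) ?ltW.
have c1 : c <= 1 by rewrite (le_trans _ a1) ?ltW.
have pi1 : 1 <= pi :> R by rewrite (le_trans _ (pi_ge2 R)) ?ler1n.
have cos_ge : cos 1 <= cos c.
  move: c1; rewrite le_eqVlt => /predU1P[-> //|c1]; rewrite ltW // ltr_cos //.
    by rewrite in_itv /= c0 (le_trans (ltW c1)).
  by rewrite in_itv /= ler01.
rewrite normrM ler_wpM2r // ger0_norm // (le_trans _ cos_ge) //.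
exact/ltW/cos1_gt0.
Qed.

Lemma norm_expi (R : realType) (t : R) : `|expi t| = 1.
Proof. by rewrite normc_def /= cos2Dsin2 sqrtr1. Qed.

Lemma expi_dist_ge (R : realType) (a b : R) :
  0 <= a <= 1 -> 0 <= b <= 1 ->
  (cos 1 * `|a - b|)%:C%C <= `|expi a - expi b|.
Proof.
move=> a1 b1; rewrite normc_def lecR /=.
apply: le_trans (sin_dist_ge a1 b1) _.
(* The modulus dominates the imaginary part. *)
by rewrite -sqrtr_sqr ler_sqrt ?lerDr ?addr_ge0 ?sqr_ge0.
Qed.

(** The difference is (j - i) / ((i+1)(j+1)), with numerator at least 1 in modulus and denominator
    at most n^2. *)
Lemma invn_dist_ge (R : realFieldType) (n i j : nat) :
  (i < n)%N -> (j < n)%N -> i != j ->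
  (n%:R ^+ 2)^-1 <= `|i.+1%:R^-1 - j.+1%:R^-1| :> R.
Proof.
move=> lin ljn ij.
have n0 : 0 < n%:R :> R by rewrite ltr0n (leq_ltn_trans _ lin).
have -> : i.+1%:R^-1 - j.+1%:R^-1 = (j%:R - i%:R) / (i.+1%:R * j.+1%:R) :> R.
  rewrite -!natr1; field.
  by rewrite !natr1 !pnatr_eq0.
rewrite normrM normfV [X in _ / X]ger0_norm ?mulr_ge0 //.
apply: (@le_trans _ _ (i.+1%:R * j.+1%:R)^-1).
  rewrite lef_pV2 ?posrE ?mulr_gt0 ?exprn_gt0 // expr2.
  by rewrite ler_pM // ler_nat.
rewrite ler_peMl ?invr_ge0 ?mulr_ge0 //.
have dist1 (p q : nat) : (p < q)%N -> 1 <= `|q%:R - p%:R| :> R.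
  by move=> pq; rewrite -natrB 1?ltnW // normr_nat ler1n subn_gt0.
by case: (ltngtP i j) ij => // [/dist1//|/dist1]; rewrite distrC.
Qed.

(** * The lower bound for the maximum *)

Lemma meval_box_poly (R : realType) (d n : nat)
    (c : {ffun 'I_d -> 'I_n} -> R[i]) (z : 'I_d -> R[i]) :
  mpoly.meval z (box_poly c) = \sum_k c k * \prod_i z i ^+ k i.
Proof.
rewrite raddf_sum; apply: eq_bigr => k _ /=.
rewrite mpoly.mevalZ mpoly.mevalX; congr (_ * _); apply: eq_bigr => i _.
by rewrite mpoly.multinomE tnth_mktuple.
Qed.

Lemma coef_le_moduli (R : realType) (d n : nat)
    (c : {ffun 'I_d -> 'I_n} -> R[i]) (L M : R) k :
  (0 < n)%N -> 1 <= L -> ubound (moduli (box_poly c) L) M ->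
  ComplexField.Normc.normc (c k) <=
    (4 / (cos 1 / (L * n%:R ^+ 2))) ^+ n.-1 ^+ d * M.
Proof.
move=> n0 L1 hM; have L0 : 0 < L by exact: lt_le_trans L1.
have cos1 := cos1_gt0 R.
(* These angles lie in [0, 1/L]: inside the arc because 1 <= pi, and inside [0, 1], where the sine
   estimate holds. *)
pose t j : R := L^-1 * j.+1%:R^-1.
have t01 j : 0 <= t j <= 1.
  by rewrite /t mulr_ge0 ?mulr_ile1 ?invr_ge0 ?invf_le1 ?ler1n // ltW.
pose delta : R := cos 1 / (L * n%:R ^+ 2).
pose x j := expi (t j).
have xdist i j :
    (cos 1 * (L^-1 * `|i.+1%:R^-1 - j.+1%:R^-1|))%:C%C <= `|x i - x j|.
  apply: le_trans (expi_dist_ge (t01 i) (t01 j)); rewrite lecR.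
  by rewrite -mulrBr normrM (gtr0_norm (x := L^-1)) ?invr_gt0.
have x_inj : injective x.
  move=> i j xij; apply/eqP; apply: contraT => ij.
  have := xdist i j; rewrite xij subrr normr0 lecR leNgt.
  rewrite !mulr_gt0 ?invr_gt0 // normr_gt0 subr_eq0.
  by rewrite (inj_eq invr_inj) eqr_nat eqSS.
have x1 j : `|x j| <= 1 by rewrite norm_expi.
have x_gamma j : gamma L (x j).
  exists (t j) => //; rewrite /= in_itv /=; have /andP[t0 _] := t01 j.
  have piL : 0 <= pi / L by rewrite divr_ge0 ?pi_ge0 // ltW.
  rewrite (le_trans _ t0) ?oppr_le0 //= /t mulrC ler_pM2r ?invr_gt0 //.
  apply: (@le_trans _ _ 1); first by rewrite invf_le1 ?ler1n.
  by rewrite (le_trans _ (pi_ge2 R)) ?ler1n.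
have delta0 : 0 < delta by rewrite divr_gt0 ?mulr_gt0 ?exprn_gt0 ?ltr0n.
have xsep (i j : 'I_n) : i != j -> delta%:C%C <= `|x i - x j|.
  move=> ij; apply: le_trans (xdist i j); rewrite lecR /delta invfM.
  rewrite ler_pM2l // ler_pM2l ?invr_gt0 //.
  exact: invn_dist_ge.
have delta0C : 0 < delta%:C%C by rewrite ltcR.
have /choice[w wP] := fun k => interpolation_weights k x_inj x1 delta0C xsep.
have hle (j : {ffun 'I_d -> 'I_n}) :
    `|\sum_l c l * \prod_i x (j i) ^+ l i| <= M%:C%C.
  rewrite -(meval_box_poly c (fun i => x (j i))) -[`|_|]/(_%:C%C) lecR.
  by apply: hM; exists (fun i => x (j i)).
have le_ck := norm_coef_le_grid (fun k => (wP k).1) (fun k => (wP k).2) hle k.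
(* The norm of R[i] is by definition the real modulus embedded in R[i], so the estimate descends to
   R. *)
rewrite -[`|c k|]/((ComplexField.Normc.normc (c k))%:C%C) in le_ck.
have E : 4 / delta%:C%C = (4 / delta)%:C%C.
  by rewrite [RHS]rmorphM [in RHS]fmorphV (rmorph_nat _ 4).
by rewrite E -!rmorphXn -rmorphM lecR in le_ck.
Qed.

Theorem corollary5p1 (R : realType) (d : nat) (hd : (1 <= d)%N) :
  exists C : R, 0 < C /\
    forall (n : nat) (c : {ffun 'I_d -> 'I_n} -> R[i]),
      (forall k, c k = 0 \/ c k = 1 \/ c k = -1) ->
      box_poly c != 0 ->
      forall L : R, 1 <= L ->
        exists M : R, is_max (moduli (box_poly c) L) M /\
          expR (- (C * (L * n%:R * ln n%:R))) <= M.
Proof.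
have cos1 := cos1_gt0 R.
pose A : R := ln (4 / cos 1).
have A0 : 0 <= A.
  by rewrite ln_ge0 // ler_pdivlMr // mul1r (le_trans (cos_le1 _)) ?ler1n.
have ln2 : 0 < ln 2 :> R by rewrite ln_gt0 ?ltr1n.
have C0 : 0 < (A + 1) / ln 2 + 2.
  by rewrite ltr_wpDl // divr_ge0 ?addr_ge0 // ltW.
(* The 2 comes from the n^2 in the separation; dividing by ln 2 lets ln n, for n >= 2, absorb the
   constant A + 1. *)
exists (d%:R * ((A + 1) / ln 2 + 2)); split; first by rewrite mulr_gt0 ?ltr0n.
move=> n c c01 h0 L L1; have L0 : 0 < L by exact: lt_le_trans L1.
have [M hM] := is_max_moduli (box_poly c) L0; exists M; split=> //.
have [k ck] : exists k, c k != 0.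
  apply/existsP; apply: contraNT h0 => /existsPn c0.
  rewrite /box_poly big1 // => k _.
  by move: (c0 k) => /negPn/eqP ->; rewrite scale0r.
(* As d >= 1, the index [k] has a coordinate, so 'I_n is inhabited. *)
have n0 : (0 < n)%N by exact: leq_ltn_trans (ltn_ord (k (Ordinal hd))).
have ck1 : ComplexField.Normc.normc (c k) = 1.
  suff : `|c k| = 1 by case.
  by case: (c01 k) ck => [->|[->|->]]; rewrite ?eqxx ?normrN ?normr1.
have := coef_le_moduli k n0 L1 hM.2; rewrite ck1 -exprM => leM.
have n0R : 0 < n%:R :> R by rewrite ltr0n.
set B := 4 / _ in leM.
have B0 : 0 < B by rewrite divr_gt0 ?divr_gt0 ?mulr_gt0 ?exprn_gt0.
(* B equals (4 / cos 1) L n^2, and L <= 1 + L <= e^L. *)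
have Ble : B <= expR (A + L + 2 * ln n%:R).
  have -> : B = 4 / cos 1 * L * n%:R ^+ 2.
    by rewrite /B; field; rewrite !lt0r_neq0.
  rewrite !expRD expRM_natl !lnK ?posrE ?divr_gt0 //.
  rewrite ler_wpM2r ?exprn_ge0 // ler_wpM2l ?divr_ge0 // ?(ltW cos1) //.
  by rewrite (le_trans _ (expR_ge1Dx _)) // lerDr.
have M0 : 0 < M by move: (lt_le_trans ltr01 leM); rewrite pmulr_rgt0 ?exprn_gt0.
(* Passing to inverses, the goal becomes an upper bound for 1/M, which is at most B^((n-1)d). *)
rewrite expRN -[M]invrK lef_pV2 ?posrE ?invr_gt0 ?expR_gt0 //.
apply: (@le_trans _ _ (B ^+ (n.-1 * d))).
  by rewrite -[M^-1]mul1r ler_pdivrMr.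
apply: (@le_trans _ _ (expR (A + L + 2 * ln n%:R) ^+ (n.-1 * d))).
  by apply: lerXn2r; rewrite ?nnegrE ?expR_ge0 // ltW.
rewrite -expRM_natl ler_expR.
(* For n = 1 the exponent n-1 and ln n are both 0, so both sides vanish; only n >= 2 remains. *)
case: n n0 {c c01 h0 hM k ck ck1 leM M0 B0 B Ble} n0R => // -[|n] _ n0R.
  by rewrite ln1 !mulr0 mul0n mul0r.
set m := n.+2; have lnm : ln 2 <= ln m%:R :> R.
  by rewrite ler_ln ?posrE ?ltr0n // ler_nat.
have lnm0 : 0 < ln m%:R :> R := lt_le_trans ln2 lnm.
have A1 : A + 1 <= (A + 1) / ln 2 * ln m%:R.
  by rewrite mulrAC ler_pdivlMr // ler_wpM2l ?addr_ge0.
rewrite natrM -!mulrA mulrCA ler_pM2l ?ltr0n //.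
(* Bound n-1 by n and, since L >= 1, factor L out of A + L + 2 ln n. *)
apply: (@le_trans _ _ (m%:R * (L * (A + 1 + 2 * ln m%:R)))).
  apply: ler_pM; rewrite ?ler0n ?ler_nat ?addr_ge0 ?mulr_ge0 //
    ?(ltW lnm0) ?(ltW L0) //.
  have : A + 2 * ln m%:R <= L * (A + 2 * ln m%:R).
    by rewrite ler_peMl // addr_ge0 // mulr_ge0 // ltW.
  by lra.
rewrite mulrCA [leRHS]mulrCA ler_pM2l // [leRHS]mulrCA ler_pM2l //.
rewrite [leRHS]mulrDl.
by rewrite lerD2r.
Qed.
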